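(* Let $U$, $L$, $T$, $P_{\sum}$, $\pi'_{\Omega}$, $P^{*}_T$, $P^{**}_T$, $U_Q$ and $BB^{+}_Q$ be as described in the context, and let $P_T$ be a program in $L$ computing a total function. Then there is a constant $C$ such that for every natural number $N$ there is a program of the form $\pi'_{\Omega}\circ P^{**}_T\circ P_T\circ 0^{|\rho|}1\circ\rho$ (for some finite bit string $\rho$) with $$U_{P^{**}_T\circ P_T}\left(\pi'_{\Omega}\circ P^{**}_T\circ P_T\circ 0^{|\rho|}1\circ\rho\right)\ge BB^{+}_{P^{**}_T\circ P_T}(N)$$ and $$\left|\pi'_{\Omega}\circ P^{**}_T\circ P_T\circ 0^{|\rho|}1\circ\rho\right|\le 2N+C.$$
   Context: $U$ is a universal Turing machine whose programming language $L$ is binary, self-delimiting (prefix-free), recursive, and recursively functionalizable: there is a computable operation $(P,w)\mapsto P\circ w\in L$ such that $U(P\circ w)$ equals the result of running program $P$ on input $w$, it is decidable whether a string has the form $P\circ w$ (and $P$, $w$ can then be recovered), and likewise for iterated concatenations $P\circ w_1\circ\dots\circ w_k$. Moreover there are constants $\epsilon, C, C'$ such that for all $P,w_1,\dots,w_k$: $|w_i|<|P\circ w_1\circ\dots\circ w_k|$, $|P\circ w_1\circ\dots\circ w_k|\le Ck+|P|+|w_1|+\dots+|w_k|$, and $H(N)\le C'+\log_2 N+(1+\epsilon)\log_2\log_2 N$, where $H(N)$ is the length of a shortest $L$-program outputting (a representation of) $N$. A natural number $N$ given as input denotes its representation in $L$. All finite bit strings are computably enumerated as $l_1=0,l_2,l_3,\dots$.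 $T$ is a program with $U(T\circ p)$ = number of steps $U$ takes to run $p$. For a program $Q$ computing a total function, the Turing submachine $U_Q$ is: $U_Q(w)=l_1$ if $U(w)$ does not halt within $U(Q\circ w)$ steps, and $U_Q(w)=l_{k+1}$ if $U(w)$ halts within $U(Q\circ w)$ steps with $U(w)=l_k$. The Busy Beaver Plus function is $BB^{+}_Q(N)=1+\max\{U_Q(w): |w|\le N\}$ (outputs read as numbers). $P_{\sum}$: $U(P_{\sum}\circ Q\circ N)$ is the finite binary sum $\sum 2^{-|p|}$ over programs $p$ with $|p|\le N$ that halt within $U(Q\circ p)$ steps; it is $0$ if $N=0$. $\pi'_{\Omega}$: on input $Q\circ 0^{|\rho|}1\circ\rho$ ($\rho$ a finite bit string read as a binary real in $[0,1]$): if $\rho=0$ it returns $0$; otherwise it finds the first $k\ge1$ such that the sum of $2^{-|p|}$ over programs $p$ of size $\le k$ halting within time $U(Q\circ p)$ is $\ge\rho$ (never halting if none exists), and returns $1+$ the largest output of $U_Q$ on programs of size $\le k$. $P^{*}_T$: given $Q$, $P_T$, $w$, it returns $U(T\circ w)$ if $w=\pi'_{\Omega}\circ Q\circ 0^{|\rho|}1\circ\rho$ for some $\rho$, and $U(P_{\sum}\circ Q\circ(|w|-1))\ge\rho$, and $U(T\circ w)>U(P_T\circ w)$; otherwise it returns $U(P_T\circ w)$. $P^{**}_T$: a self-referential program with $U(P^{**}_T\circ P_T\circ w)=U(P^{*}_T\circ P^{**}_T\circ P_T\circ P_T\circ w)$ for all $w$ (it reads itself and assembles this string). When $P_T$ is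 total, $P^{**}_T\circ P_T$ computes a total function, so $U_{P^{**}_T\circ P_T}$ and $BB^{+}_{P^{**}_T\circ P_T}$ are defined.
   Formalization: The bound |P∘w_1∘…∘w_k| ≤ Ck+|P|+Σ|w_i| for all strings contradicts prefix-freeness of L (Kraft), so it is assumed only when each w_i is in L, has the form 0^n1, or directly follows 0^{|w_i|}1. *)

(* Defs.v *)
From HB Require Import structures.
From mathcomp Require Import all_boot all_order all_algebra.
From mathcomp Require Import boolp reals exp.

Set Implicit Arguments.
Unset Strict Implicit.
Unset Printing Implicit Defensive.

Import Order.TTheory GRing.Theory Num.Theory.

Definition bits := seq bool.

Inductive direction := Left | Stay | Right.

(* Deterministic single-tape machines.  Tape symbols are blank ([None]), bits
   ([Some (inl b)]) and auxiliary symbols ([Some (inr x)]); the machine halts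
   when no transition applies. *)
Record TM := MkTM {
  tm_state : finType;
  tm_aux : finType;
  tm_start : tm_state;
  tm_trans : tm_state -> option (bool + tm_aux) ->
             option (tm_state * option (bool + tm_aux) * direction) }.

Section Run.
Variable M : TM.

Let sym := option (bool + tm_aux M).

(* [(q, l, r)]: the scanned cell is the head of [r], [l] is the tape to its
   left read leftwards, and all other cells are blank. *)
Definition config : Type := (tm_state M * seq sym * seq sym)%type.

Definition tm_init (w : bits) : config :=
  (tm_start M, [::], [seq Some (inl b) | b <- w]).

Definition tm_step (c : config) : option config :=
  let: (q, l, r) := c in
  match tm_trans q (head None r) with
  | None => None
  | Some (q', a, Left) => Some (q', behead l, [:: head None l, a & behead r])
  | Some (q', a, Stay) => Some (q', l, a :: behead r)
  | Some (q', a, Right) => Some (q', a :: l, behead r)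
  end.

Fixpoint tm_run (n : nat) (c : config) : config :=
  if n is n'.+1 then
    if tm_step c is Some c' then tm_run n' c' else c
  else c.

Definition tm_halted (c : config) : bool := ~~ isSome (tm_step c).

(* the output is the maximal block of bits starting at the scanned cell *)
Fixpoint leading_bits (r : seq sym) : bits :=
  if r is Some (inl b) :: r' then b :: leading_bits r' else [::].

Definition tm_output (c : config) : bits := leading_bits c.2.

Definition tm_time (w : bits) : option nat :=
  match pselect (exists n, tm_halted (tm_run n (tm_init w))) with
  | left h => Some (ex_minn h)
  | right _ => None
  end.

Definition tm_eval (w : bits) : option bits :=
  omap (fun n => tm_output (tm_run n (tm_init w))) (tm_time w).

End Run.

Definition zeros1 (n : nat) : bits := rcons (nseq n false) true.

(* tuples of strings as single strings, used to feed several arguments to a TM *)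
Definition code (ws : seq bits) : bits :=
  flatten [seq zeros1 (size w) ++ w | w <- ws].

(* b_1 ... b_n is read as the binary fraction 0.b_1...b_n *)
Fixpoint binval (r : bits) : rat :=
  (if r is b :: r' then ((b : nat)%:R + binval r') / 2%:R else 0)%R.

(* P o w_1 o ... o w_k = (... (P o w_1) o ...) o w_k *)
Definition comps (circ : bits -> bits -> bits) (P : bits) (ws : seq bits) : bits :=
  foldl circ P ws.

(* The input sequences to which the bound |P o w_1 o ... o w_k| <=
   C k + |P| + |w_1| + ... + |w_k| applies: each w_i is a word of the language,
   or a unary length marker 0^n 1, or is announced by the marker of its own
   length, as in ... o 0^|w| 1 o w.  The bound cannot be required for all
   strings: by Kraft's inequality the lengths of the words P o w of a prefix-free
   set, w ranging over all strings, are not bounded by C + |P| + |w|. *)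
Definition delimited (L : pred bits) (ws : seq bits) : Prop :=
  forall i, i < size ws ->
    [\/ L (nth [::] ws i),
        exists n, nth [::] ws i = zeros1 n
      | 0 < i /\ nth [::] ws i.-1 = zeros1 (size (nth [::] ws i)) ].

Definition log2 (R : realType) (x : R) : R := (ln x / ln 2%:R)%R.

(* h = H(N), where the string [num N] stands for N in outputs *)
Definition complexity (V : TM) (L : pred bits) (num : nat -> bits) (N h : nat) : Prop :=
  (exists p, [/\ L p, tm_eval V p = Some (num N) & size p = h]) /\
  (forall p, L p -> tm_eval V p = Some (num N) -> h <= size p).

(* [umU] is the machine U, [umL] its programming language and [circ P w] is
   P o w, where P is a program and w any string.  [lstr n] is l_{n+1} and is the
   numeral read as n in outputs, so that l_1 is read as 0; [lidx] is this
   reading.  [numL n] is the representation of n in the language, used when n is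
   given as an input. *)
Record universal_machine (R : realType) := MkUniversalMachine {
  umU : TM;
  umL : pred bits;
  circ : bits -> bits -> bits;
  lstr : nat -> bits;
  lidx : bits -> nat;
  numL : nat -> bits;

  lstrK : cancel lstr lidx;
  lidxK : cancel lidx lstr;
  lstr0 : lstr 0 = [:: false];
  lstr_computable : exists M : TM,
    forall n, tm_eval M (nseq n true) = Some (lstr n);

  umL_prefix_free : forall p q, umL p -> umL q -> prefix p q -> p = q;
  umL_recursive : exists M : TM,
    forall w, tm_eval M w = Some [:: umL w];

  numL_umL : forall n, umL (numL n);
  numL_inj : injective numL;
  numL_computable : exists M : TM,
    forall n, tm_eval M (nseq n true) = Some (numL n);

  circ_umL : forall P w, umL P -> umL (circ P w);
  circ_computable : exists M : TM,
    forall P ws, umL P -> tm_eval M (code (P :: ws)) = Some (comps circ P ws);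
  circ_recover : forall k, exists M : TM,
    (forall P ws, umL P -> size ws = k ->
       tm_eval M (comps circ P ws) = Some (true :: code (P :: ws))) /\
    (forall x, (forall P ws, umL P -> size ws = k -> x <> comps circ P ws) ->
       tm_eval M x = Some [:: false]);

  umU_universal : forall (k : nat) (M : TM), exists2 P, umL P &
    forall ws, size ws = k -> tm_eval umU (comps circ P ws) = tm_eval M (code ws);

  circ_size_gt : forall P ws w, umL P -> w \in ws -> size w < size (comps circ P ws);
  circ_size_le : exists C : nat, forall P ws, umL P -> delimited umL ws ->
    size (comps circ P ws) <= C * size ws + size P + sumn (map size ws);

  complexity_le : exists eps C' : R, forall N, 2 <= N ->
    exists2 h, complexity umU umL lstr N h &
      (h%:R <= C' + log2 N%:R + (1 + eps) * log2 (log2 N%:R))%R }.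

Arguments umU {R} _.
Arguments umL {R} _.
Arguments circ {R} _ _ _.
Arguments lstr {R} _ _.
Arguments lidx {R} _ _.
Arguments numL {R} _ _.

Section Programs.
Variables (R : realType) (UM : universal_machine R).

Local Notation L := (umL UM).
Local Notation "P <o> w" := (circ UM P w) (at level 40, left associativity).

Definition U (w : bits) : option bits := tm_eval (umU UM) w.

Definition Utime (w : bits) : option nat := tm_time (umU UM) w.

Definition defined (o : option bits) : Prop := o <> None.

Definition total_program (P : bits) : Prop := forall w, defined (U (P <o> w)).

Definition in_time (Q w : bits) : bool :=
  match Utime w, U (Q <o> w) with
  | Some t, Some s => t <= lidx UM s
  | _, _ => false
  end.

(* U_Q; meaningful when Q is total *)
Definition submachine (Q w : bits) : bits :=
  if in_time Q w then
    if U w is Some s then lstr UM (lidx UM s).+1 else lstr UM 0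
  else lstr UM 0.

Definition max_output (Q : bits) (N : nat) : nat :=
  \max_(n < N.+1) \max_(p : n.-tuple bool | L p) lidx UM (submachine Q p).

Definition BBplus (Q : bits) (N : nat) : nat := (max_output Q N).+1.

Definition halting_sum (Q : bits) (N : nat) : rat :=
  (\sum_(n < N.+1) \sum_(p : n.-tuple bool | L p && in_time Q p) 2%:R ^- n)%R.

Definition is_T (T : bits) : Prop :=
  L T /\ forall p, L p -> U (T <o> p) = omap (lstr UM) (Utime p).

(* The specifications of P_Sigma and pi'_Omega only require U(Q o p) to be
   defined for the programs p actually inspected: they are applied to Q before Q
   is known to be total. *)
Definition defined_upto (Q : bits) (N : nat) : Prop :=
  forall p, L p -> size p <= N -> defined (U (Q <o> p)).

Definition is_Psum (Psum : bits) : Prop :=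
  L Psum /\ forall Q N, L Q -> defined_upto Q N ->
    exists2 s, U (Psum <o> Q <o> numL UM N) = Some s &
      binval s = if N == 0 then 0%R else halting_sum Q N.

Definition pi_prog (pi Q r : bits) : bits := pi <o> Q <o> zeros1 (size r) <o> r.

Definition is_pi (pi : bits) : Prop :=
  L pi /\ forall Q r, L Q ->
    [/\ binval r = 0%R -> U (pi_prog pi Q r) = Some (lstr UM 0),
        forall k, binval r <> 0%R -> 1 <= k -> defined_upto Q k ->
          (binval r <= halting_sum Q k)%R ->
          (forall j, 1 <= j < k -> (halting_sum Q j < binval r)%R) ->
          U (pi_prog pi Q r) = Some (lstr UM (max_output Q k).+1)
      & binval r <> 0%R -> (forall k, defined_upto Q k) ->
          (forall k, 1 <= k -> (halting_sum Q k < binval r)%R) ->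
          U (pi_prog pi Q r) = None].

Definition is_Pstar (T Psum pi Pstar : bits) : Prop :=
  L Pstar /\ forall Q PT w, L Q -> L PT ->
    ((forall r, w <> pi_prog pi Q r) ->
       U (Pstar <o> Q <o> PT <o> w) = U (PT <o> w)) /\
    (forall r s, w = pi_prog pi Q r ->
       U (Psum <o> Q <o> numL UM (size w).-1) = Some s ->
       ((binval s < binval r)%R ->
          U (Pstar <o> Q <o> PT <o> w) = U (PT <o> w)) /\
       (forall t b, (binval r <= binval s)%R ->
          U (T <o> w) = Some t -> U (PT <o> w) = Some b ->
          U (Pstar <o> Q <o> PT <o> w) =
            Some (if lidx UM b < lidx UM t then t else b))).

(* the first argument of P*_T is the word P**_T o P_T *)
Definition is_Pstarstar (Pstar Pss : bits) : Prop :=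
  L Pss /\ forall PT w, L PT ->
    U (Pss <o> PT <o> w) = U (Pstar <o> (Pss <o> PT) <o> PT <o> w).

End Programs.

(* Main.v *)
Require Import Defs.
From mathcomp Require Import all_boot all_order all_algebra.
From mathcomp Require Import boolp reals exp.
From mathcomp Require Import zify.

(** Write [Q] for [P**_T o P_T].  [Q] is total by induction on the size of its
    input: a program [w = pi o Q o 0^|r|1 o r] of size [n] is only timed by [T]
    once the halting sum over the strictly shorter programs reaches [r], and in
    that case [pi] halts on it.  Given [N], let [r] be the [N]-bit expansion of
    the halting sum at [N]; it is smaller than [1] by the strict Kraft inequality,
    as the language is infinite.  Since [N < |w|], the test of [P*_T] succeeds, so
    [Q] grants [w] its own running time; and [pi] stops at a size [k <= N] beyond
    which no program of size at most [N] halts in time, hence it outputs one more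
    than the largest output of [U_Q] on programs of size at most [N]. *)

Set Implicit Arguments.
Unset Strict Implicit.
Unset Printing Implicit Defensive.

Import Order.TTheory GRing.Theory Num.Theory.

(** * Kraft's inequality *)

Definition prefix_free (P : pred bits) : Prop :=
  forall p q, P p -> P q -> prefix p q -> p = q.

(* [2 ^ N] times the sum of [2 ^ - size p] over the words [p] of size at most [N] *)
Definition kraft_sum (P : pred bits) (N : nat) : nat :=
  \sum_(n < N.+1) \sum_(p : n.-tuple bool | P p) 2 ^ (N - n).

Lemma big_tuple0 (P : pred bits) (F : nat) :
  \sum_(p : 0.-tuple bool | P p) F = P [::] * F.
Proof.
rewrite (eq_bigl (fun p : 0.-tuple bool => P [::] && (p == [tuple]))).
  case: (P [::]); last by rewrite big_pred0 ?mul0n.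
  by rewrite (big_pred1 [tuple]) // mul1n.
by move=> p; rewrite [p]tuple0 (eqxx [tuple]) andbT.
Qed.

Lemma big_tupleS (n : nat) (P : pred bits) (F : nat) :
  \sum_(p : n.+1.-tuple bool | P p) F =
  \sum_(p : n.-tuple bool | P (true :: p)) F +
  \sum_(p : n.-tuple bool | P (false :: p)) F.
Proof.
pose h (u : bool * n.-tuple bool) : n.+1.-tuple bool := [tuple of u.1 :: u.2].
rewrite (reindex h) /=; last first.
  exists (fun p : n.+1.-tuple bool => (thead p, behead_tuple p)).
    by move=> [b p] _; rewrite /h /=; congr pair; apply: val_inj.
  by move=> p _; rewrite /h /= [RHS]tuple_eta; apply: val_inj.
rewrite -(pair_big_dep xpredT (fun b (p : n.-tuple bool) => P (b :: p))
  (fun _ _ => F)) /=.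
by rewrite big_bool.
Qed.

(** Sorting words by their first letter moves from [N.+1] to [N], so that Kraft's inequality follows
    by induction on [N]. *)
Lemma kraft_sumS (P : pred bits) (N : nat) :
  kraft_sum P N.+1 = P [::] * 2 ^ N.+1 +
    (kraft_sum (fun p => P (true :: p)) N + kraft_sum (fun p => P (false :: p)) N).
Proof.
rewrite /kraft_sum big_ord_recl big_tuple0 subn0 -big_split /=; congr addn.
by apply: eq_bigr => n _; rewrite big_tupleS.
Qed.

Lemma kraft_sum0 (P : pred bits) : kraft_sum P 0 = P [::].
Proof. by rewrite /kraft_sum big_ord_recl big_ord0 big_tuple0 addn0 muln1. Qed.

Lemma kraft_sum_pred0 (P : pred bits) (N : nat) : P =1 xpred0 -> kraft_sum P N = 0.
Proof. by move=> P0; rewrite /kraft_sum big1 // => n _; rewrite big_pred0. Qed.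

Lemma prefix_free_cons (P : pred bits) (b : bool) :
  prefix_free P -> prefix_free (fun p => P (b :: p)).
Proof.
by move=> Pf p q Pp Pq pq; have := Pf _ _ Pp Pq; rewrite /= eqxx => /(_ pq) [].
Qed.

(** The empty word, if present, is the only word; otherwise each first letter accounts for at most
    half of the total. *)
Lemma kraft_le (P : pred bits) (N : nat) : prefix_free P -> kraft_sum P N <= 2 ^ N.
Proof.
elim: N P => [|N IHN] P Pf; first by rewrite kraft_sum0 leq_b1.
rewrite kraft_sumS; case P0: (P [::]); last first.
  rewrite mul0n add0n expnS mul2n -addnn.
  by apply: leq_add; apply: IHN; apply: prefix_free_cons.
have Pcons b : (fun p => P (b :: p)) =1 xpred0.
  by move=> p; apply/negP => /(Pf _ _ P0) /(_ (prefix0s _)).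
by rewrite !kraft_sum_pred0 ?mul1n ?addn0.
Qed.

(** The word [q] is too long to be counted but still excludes its prefixes: along its letters one
    branch stays strict, and [kraft_le] bounds the other. *)
Lemma kraft_lt (P : pred bits) (N : nat) (q : bits) :
  prefix_free P -> P q -> N < size q -> kraft_sum P N < 2 ^ N.
Proof.
elim: N P q => [|N IHN] P [//|b q] Pf Pq sq;
    have P0 : P [::] = false by apply/negP => /Pf /(_ Pq) /(_ (prefix0s _)).
  by rewrite kraft_sum0 P0.
have lt_b := IHN _ q (prefix_free_cons (b := b) Pf) Pq sq.
have le_b := kraft_le N (prefix_free_cons (b := ~~ b) Pf).
rewrite kraft_sumS P0 mul0n expnS.
by case: b lt_b le_b {Pq sq} => /=; lia.
Qed.

Lemma kraft_sum_sub (P P' : pred bits) (N : nat) :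
  subpred P P' -> kraft_sum P N <= kraft_sum P' N.
Proof.
move=> PP'; apply: leq_sum => n _.
rewrite big_mkcond [leqRHS]big_mkcond; apply: leq_sum => p _.
by case: ifP => // /PP' ->.
Qed.

Lemma injective_size_unbounded (f : nat -> bits) (N : nat) :
  injective f -> exists n, N < size (f n).
Proof.
move=> f_inj; apply: contrapT => /forallNP bounded.
(* All strings of size at most [N]: a finite list, too short for the values of [f] at
   [(size words).+1] arguments. *)
pose words := flatten [seq map val (enum {: n.-tuple bool}) | n <- iota 0 N.+1].
have: size (map f (iota 0 (size words).+1)) <= size words.
  apply: uniq_leq_size => [|_ /mapP[n _ ->]]; first by rewrite map_inj_uniq ?iota_uniq.
  apply/flatten_mapP; exists (size (f n)).
    by rewrite mem_iota add0n leq0n /= ltnNge; apply/negP/(bounded n).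
  by apply/mapP; exists (in_tuple (f n)); rewrite ?mem_enum.
by rewrite size_map size_iota ltnn.
Qed.

(** * Binary fractions *)

Local Open Scope ring_scope.

Lemma binval_ge0 (r : bits) : 0 <= binval r.
Proof.
by elim: r => //= b r IHr; rewrite divr_ge0 ?addr_ge0 ?ler0n.
Qed.

Lemma binval_surj (N m : nat) :
  (m < 2 ^ N)%N -> exists2 r, size r = N & binval r = m%:R / 2 ^+ N.
Proof.
elim: N m => [|N IHN] m.
  by rewrite ltnS leqn0 => /eqP ->; exists [::]; rewrite //= mul0r.
(* [b] is the leading bit of [m], of weight [2 ^ N]. *)
have step (b : bool) m' : m = (b * 2 ^ N + m')%N -> (m' < 2 ^ N)%N ->
    exists2 r, size r = N.+1 & binval r = m%:R / 2 ^+ N.+1.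
  move=> -> /IHN[r sr vr]; exists (b :: r); first by rewrite /= sr.
  rewrite /= vr natrD natrM natrX exprS invfM mulrCA mulrC.
  by rewrite [in RHS]mulrDl mulfK // expf_neq0.
rewrite expnS => lt_m; case: (ltnP m (2 ^ N)) => le_m.
  by apply: (step false).
by apply: (step true (m - 2 ^ N)%N); lia.
Qed.

(** * Halting sums *)

Section HaltingSum.
Variables (R : realType) (UM : universal_machine R) (Q : bits).

Lemma halting_sum_kraft (N : nat) :
  halting_sum UM Q N =
  (kraft_sum (fun p => umL UM p && in_time UM Q p) N)%:R / 2 ^+ N.
Proof.
rewrite /halting_sum /kraft_sum natr_sum mulr_suml.
apply: eq_bigr => n _; rewrite natr_sum mulr_suml; apply: eq_bigr => p _.
rewrite natrX; apply: (canRL (mulfK _)); first by rewrite expf_neq0.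
have le_nN : (n <= N)%N by rewrite -ltnS.
have -> : 2 ^+ N = 2 ^+ (N - n) * 2 ^+ n :> rat by rewrite -exprD subnK.
by rewrite mulrCA mulVf ?mulr1 // expf_neq0.
Qed.

Lemma halting_sum_binval (N : nat) :
  exists2 r, size r = N & binval r = halting_sum UM Q N.
Proof.
rewrite halting_sum_kraft; apply: binval_surj.
(* The numerals [numL n] are infinitely many programs, so one of them is longer than [N] and makes
   Kraft's inequality strict. *)
have [n lt_n] := injective_size_unbounded N (@numL_inj _ UM).
apply: leq_ltn_trans (kraft_lt (@umL_prefix_free _ UM) (numL_umL UM n) lt_n).
by apply: kraft_sum_sub => p /andP[].
Qed.

Lemma halting_sum_ge0 (N : nat) : 0 <= halting_sum UM Q N.
Proof. by rewrite halting_sum_kraft divr_ge0 ?exprn_ge0 ?ler0n. Qed.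

Let mass (n : nat) : rat :=
  \sum_(p : n.-tuple bool | umL UM p && in_time UM Q p) 2%:R ^- n.

Let mass_ge0 (n : nat) : 0 <= mass n.
Proof. by rewrite sumr_ge0 // => p _; rewrite invr_ge0 exprn_ge0. Qed.

Let mass_gt0 (p : bits) : umL UM p -> in_time UM Q p -> 0 < mass (size p).
Proof.
move=> Lp tp; rewrite /mass (bigD1 (in_tuple p)) /= ?Lp ?tp //.
by rewrite ltr_wpDr ?invr_gt0 ?exprn_gt0 // sumr_ge0 // => q _;
  rewrite invr_ge0 exprn_ge0.
Qed.

Let halting_sumS (N : nat) :
  halting_sum UM Q N.+1 = halting_sum UM Q N + mass N.+1.
Proof. by rewrite /halting_sum big_ord_recr. Qed.

Lemma halting_sum_mono (M N : nat) :
  (M <= N)%N -> halting_sum UM Q M <= halting_sum UM Q N.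
Proof.
move=> /subnKC <-; elim: (N - M)%N => [|d IHd]; first by rewrite addn0.
by rewrite addnS halting_sumS (le_trans IHd) // lerDl.
Qed.

Lemma halting_sum_gt0 (N : nat) (p : bits) :
  umL UM p -> in_time UM Q p -> (size p <= N)%N -> 0 < halting_sum UM Q N.
Proof.
move=> Lp tp le_pN; apply: lt_le_trans (halting_sum_mono le_pN).
have := mass_gt0 Lp tp; case: (size p) => [|n] gt0.
  by rewrite /halting_sum big_ord_recl big_ord0 addr0.
by rewrite halting_sumS ltr_wpDl // halting_sum_ge0.
Qed.

Lemma halting_sum_lt (M N : nat) (p : bits) :
  umL UM p -> in_time UM Q p -> (M < size p <= N)%N ->
  halting_sum UM Q M < halting_sum UM Q N.
Proof.
move=> Lp tp /andP[lt_Mp le_pN]; apply: lt_le_trans (halting_sum_mono le_pN).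
have := mass_gt0 Lp tp; case: (size p) lt_Mp => [//|n] lt_Mn gt0.
by rewrite halting_sumS (le_lt_trans (halting_sum_mono (lt_Mn : (M <= n)%N))) // ltrDl.
Qed.

Lemma leq_max_output (N : nat) (p : bits) : umL UM p -> (size p <= N)%N ->
  (lidx UM (submachine UM Q p) <= max_output UM Q N)%N.
Proof.
move=> Lp le_pN; rewrite /max_output.
have lt_pN : (size p < N.+1)%N by [].
apply: leq_trans (leq_bigmax (Ordinal lt_pN)).
exact: (leq_bigmax_cond (in_tuple p)).
Qed.

(** A program that misses its deadline outputs [lstr 0], which reads as [0] and cannot raise the
    maximum. *)
Lemma max_output_leP (N b : nat) :
  (forall p, umL UM p -> (size p <= N)%N -> in_time UM Q p ->
     (lidx UM (submachine UM Q p) <= b)%N) ->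
  (max_output UM Q N <= b)%N.
Proof.
move=> le_b; apply/bigmax_leqP => n _; apply/bigmax_leqP => p Lp.
case tp: (in_time UM Q p); first by rewrite le_b // size_tuple -ltnS.
by rewrite /submachine tp lstrK.
Qed.

(** A program of size in [(M, N]] halting in time would make the sum at [N] strictly larger than at
    [M]. *)
Lemma max_output_stable (M N : nat) :
  halting_sum UM Q N <= halting_sum UM Q M ->
  (max_output UM Q N <= max_output UM Q M)%N.
Proof.
move=> le_NM; apply: max_output_leP => p Lp le_pN tp.
case: (leqP (size p) M) => [|lt_Mp]; first exact: leq_max_output.
by have := halting_sum_lt Lp tp (introT andP (conj lt_Mp le_pN)); rewrite ltNge le_NM.
Qed.

End HaltingSum.

(** * The self-timing programs *)

Section SelfTiming.
Variables (R : realType) (UM : universal_machine R).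
Variables (T Psum pi Pstar Pss PT : bits).
Hypotheses (hT : is_T UM T) (hPsum : is_Psum UM Psum) (hpi : is_pi UM pi).
Hypotheses (hPstar : is_Pstar UM T Psum pi Pstar) (hPss : is_Pstarstar UM Pstar Pss).
Hypotheses (hPT : umL UM PT) (hPT_total : total_program UM PT).

Let Q := circ UM Pss PT.

Let LQ : umL UM Q. Proof. by apply: circ_umL; case: hPss. Qed.

Lemma pi_progE (r : bits) :
  pi_prog UM pi Q r = comps (circ UM) pi [:: Q; zeros1 (size r); r].
Proof. by []. Qed.

Lemma umL_pi_prog (r : bits) : umL UM (pi_prog UM pi Q r).
Proof. by case: hpi => Lpi _; do 3!apply: circ_umL. Qed.

Lemma ltn_size_pi_prog (r : bits) : (size r < size (pi_prog UM pi Q r))%N.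
Proof.
by case: hpi => Lpi _; rewrite pi_progE circ_size_gt // !inE eqxx !orbT.
Qed.

Lemma pi_prog_size_le :
  exists C, forall r, (size (pi_prog UM pi Q r) <= 2 * size r + C)%N.
Proof.
case: hpi => Lpi _; have [C leC] := circ_size_le UM.
(* Three arguments follow [pi]; the string [r] is paid for twice, in its marker and in itself, and
   the [1] is the closing bit of the marker. *)
exists (C * 3 + size pi + size Q + 1)%N => r; rewrite pi_progE.
apply: leq_trans (leC _ _ Lpi _) _; last by rewrite /= /zeros1 size_rcons size_nseq; lia.
case=> [|[|[|//]]] _ /=.
- exact: Or31.
- by apply: Or32; exists (size r).
- exact: Or33.
Qed.

Lemma U_Utime (w : bits) : defined (U UM w) -> exists t, Utime UM w = Some t.
Proof.
by rewrite /U /Utime /tm_eval; case: (tm_time _ w) => [t|] // _; exists t.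
Qed.

(** The search of [pi] stops at some [k <= M], so it consults [Q] only on programs of size at most
    [M]; this makes the lemma usable before [Q] is known to be total. *)
Lemma U_pi_prog (r : bits) (M : nat) : binval r <> 0 -> (1 <= M)%N ->
  defined_upto UM Q M -> binval r <= halting_sum UM Q M ->
  exists k, [/\ (k <= M)%N, binval r <= halting_sum UM Q k
    & U UM (pi_prog UM pi Q r) = Some (lstr UM (max_output UM Q k).+1)].
Proof.
move=> r_neq0 M_gt0 defM le_rM.
have exk : exists k, (1 <= k)%N && (binval r <= halting_sum UM Q k).
  by exists M; rewrite M_gt0.
case: (ex_minnP exk) => k /andP[k_gt0 le_rk] k_min.
have le_kM : (k <= M)%N by rewrite k_min ?M_gt0.
exists k; split=> //; case: hpi => _ /(_ Q r LQ)[_ pik _]; apply: pik => //.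
  by move=> p Lp le_pk; apply: defM => //; apply: leq_trans le_kM.
move=> j /andP[j_gt0 lt_jk]; rewrite ltNge; apply/negP => le_rj.
by have := k_min j; rewrite j_gt0 le_rj leqNgt lt_jk => /(_ isT).
Qed.

Lemma U_pi_prog_defined (r : bits) (M : nat) : defined_upto UM Q M ->
  binval r <= (if M == 0%N then 0 else halting_sum UM Q M) ->
  defined (U UM (pi_prog UM pi Q r)).
Proof.
move=> defM le_r.
have [r0|/eqP r_neq0] := eqVneq (binval r) 0.
  by case: hpi => _ /(_ Q r LQ)[-> //].
case: eqP le_r => [_ le_r|/eqP M_neq0 le_r].
  by case: r_neq0; apply/eqP; rewrite eq_le le_r binval_ge0.
by have [|k [_ _ ->]] := U_pi_prog r_neq0 _ defM le_r; rewrite ?lt0n.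
Qed.

(** The test of [Pstar] succeeds, so [Q] answers with the larger of the true running time and the
    bound given by [PT]. Only shorter programs need be covered by [Q], as the induction for totality
    requires. *)
Lemma U_Pss_pi_prog (r : bits) : let w := pi_prog UM pi Q r in
  let M := (size w).-1 in
  defined_upto UM Q M ->
  binval r <= (if M == 0%N then 0 else halting_sum UM Q M) ->
  exists t b, [/\ Utime UM w = Some t, U UM (circ UM Q w) = Some b & (t <= lidx UM b)%N].
Proof.
move=> w M defM le_r.
have [t tw] := U_Utime (U_pi_prog_defined defM le_r).
have [s Us vs] := (proj2 hPsum) Q M LQ defM.
case Ub: (U UM (circ UM PT w)) => [b|]; last by have := hPT_total Ub.
have UT : U UM (circ UM T w) = Some (lstr UM t).
  by rewrite (proj2 hT) ?umL_pi_prog // tw.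
have [_ /(_ r s erefl Us) [_ Pw]] := (proj2 hPstar) Q PT w LQ hPT.
rewrite -vs in le_r; have := Pw _ _ le_r UT Ub; rewrite lstrK.
rewrite -(proj2 hPss) // -/Q => UQ.
eexists t, _; split; [by []|exact: UQ|].
by case: ltnP => // _; rewrite lstrK.
Qed.

Lemma Pss_total : total_program UM Q.
Proof.
move=> w; have [n] := ubnP (size w).
elim: n w => // n IHn w lt_wn.
have UQ : U UM (circ UM Q w) = U UM (circ UM (circ UM (circ UM Pstar Q) PT) w).
  exact: (proj2 hPss).
have [not_pi is_pi] := (proj2 hPstar) Q PT w LQ hPT.
have [[r wE]|/forallNP w_npi] := pselect (exists r, w = pi_prog UM pi Q r); last first.
  by rewrite UQ not_pi //; apply: hPT_total.
have defM : defined_upto UM Q (size w).-1.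
  move=> p _ le_pw; apply: IHn.
  have := ltn_size_pi_prog r; rewrite -wE; lia.
have [s Us vs] := (proj2 hPsum) Q _ LQ defM.
have [le_rs|lt_sr] := leP (binval r) (binval s).
  have := @U_Pss_pi_prog r; rewrite -wE => /(_ defM); rewrite -vs => /(_ le_rs).
  by move=> [t [b [_ -> _]]].
by rewrite UQ (proj1 (is_pi _ _ wE Us) lt_sr); apply: hPT_total.
Qed.

Lemma BBplus_attained (N : nat) : exists2 r, size r = N &
  (BBplus UM Q N <= lidx UM (submachine UM Q (pi_prog UM pi Q r)))%N.
Proof.
have [r sr vr] := halting_sum_binval UM Q N; exists r => //.
have defQ M : defined_upto UM Q M by move=> p _ _; apply: Pss_total.
set w := pi_prog UM pi Q r.
have le_Nw : (N <= (size w).-1)%N by have := ltn_size_pi_prog r; rewrite sr -/w; lia.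
(* A zero sum means that no program of size at most [N] halts in time. *)
have r0P : binval r = 0 -> max_output UM Q N = 0%N.
  move=> r0; apply/eqP; rewrite -leqn0; apply: max_output_leP => p Lp le_pN tp.
  by have := halting_sum_gt0 Lp tp le_pN; rewrite -vr r0 ltxx.
have N_gt0 : binval r <> 0 -> (0 < N)%N by case: (N) sr => // /size0nil ->.
have tw : in_time UM Q w.
  have [||t [b [tw UQw le_tb]]] := @U_Pss_pi_prog r; first exact: defQ.
    (* If [(size w).-1] is [0], then so is [N], hence [r] is empty and has value [0]. *)
    case: eqP => [w0|_]; last by rewrite vr halting_sum_mono.
    rewrite -/w in w0; rewrite le_eqVlt; apply/orP; left; apply/negPn/negP.
    by move=> /eqP /N_gt0; lia.
  by rewrite /in_time tw UQw.
rewrite /submachine tw /BBplus.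
(* When [r] has value [0], [pi] outputs [lstr 0], and the index shift of [submachine] alone supplies
   the [1] in [BBplus]. Otherwise [pi] adds one as well, which leaves a slack of one. *)
have [r0|/eqP r_neq0] := eqVneq (binval r) 0.
  case: hpi => _ /(_ Q r LQ)[/(_ r0) -> _ _].
  by rewrite !lstrK r0P.
have [|k [_ le_rk ->]] := U_pi_prog r_neq0 (N_gt0 r_neq0) (defQ N).
  by rewrite vr.
by rewrite !lstrK ltnS ltnW // ltnS max_output_stable // -vr.
Qed.

End SelfTiming.

Local Close Scope ring_scope.

Theorem theorem10p2 (R : realType) (UM : universal_machine R)
    (T Psum pi Pstar Pss PT : bits)
    (hT : is_T UM T) (hPsum : is_Psum UM Psum) (hpi : is_pi UM pi)
    (hPstar : is_Pstar UM T Psum pi Pstar) (hPss : is_Pstarstar UM Pstar Pss)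
    (hPT : umL UM PT) (hPT_total : total_program UM PT) :
  exists C : nat, forall N : nat, exists r : bits,
    BBplus UM (circ UM Pss PT) N <=
      lidx UM (submachine UM (circ UM Pss PT) (pi_prog UM pi (circ UM Pss PT) r)) /\
    size (pi_prog UM pi (circ UM Pss PT) r) <= 2 * N + C.
Proof.
have [C leC] := pi_prog_size_le hpi hPss hPT.
exists C => N.
have [r sr le_BB] := BBplus_attained hT hPsum hpi hPstar hPss hPT hPT_total N.
by exists r; split=> //; rewrite -sr.
Qed.
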